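(* Let $r > 1$ and $k > 1$ be integers with $W(r,k) > \max(\{r,k\})$, let $n \geq 1$ be the exponent of the leading power of $r$ in the base-$r$ expansion of $W(r,k)$, and suppose that $W(r,k) < r^{n+1} \leq r^{k^{2}}$ (the second inequality being the condition $k \geq \sqrt{n+1}$). Then the following five conditions also hold: 1. $n > \dfrac{\log k}{\log r} - 1$. 2. $\sqrt[n+1]{k} = O(r)$. 3. For each triplet $n, r, k$ there exists $a(r,k) \in \mathbb{R}$ such that $n = a(r,k)\dfrac{\log k}{\log r} - 1$ if and only if $a(r,k) = (n+1)\dfrac{\log r}{\log k}$, where, if $r<k$ then $a(r,k) < n+1$, if $r = k$ then $a(r,k) = n+1$, and if $r > k$ then $a(r,k) > n+1$. 4. For each triplet $n, r, k$ there exists $a(r,k) \in \mathbb{R}$ such that $k = r^{\frac{n+1}{a(r,k)}}$ if and only if $a(r,k) = (n+1)\dfrac{\log r}{\log k}$, where, if $r<k$ then $a(r,k) < n+1$, if $r = k$ then $a(r,k) = n+1$, and if $r > k$ then $a(r,k) > n+1$. 5. For large $n$, $\dfrac{W(r,k)}{r^{n}} = O(r)$.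
   Context: For positive integers $r, k$, the van der Waerden number $W(r,k)$ is the least positive integer $N$ such that every coloring of the integer interval $[1,N]=\{1,\dots,N\}$ with $r$ colors contains a monochromatic arithmetic progression of $k$ terms. For $W(r,k) > r > 1$, write the base-$r$ expansion $W(r,k) = b_{n}r^{n} + b_{n-1}r^{n-1} + \cdots + b_{0}$ with integers $1 \leq b_n \leq r-1$ and $0 \leq b_i \leq r-1$ for $i<n$; the exponent $n$ of the leading power is the unique integer with $r^{n} \leq W(r,k) < r^{n+1}$. $O(\cdot)$ is the usual big-O notation. *)

(* Defs.v *)
From HB Require Import structures.
From mathcomp Require Import all_boot all_order all_algebra.
From mathcomp Require Import all_classical all_reals all_analysis.

Set Implicit Arguments.
Unset Strict Implicit.
Unset Printing Implicit Defensive.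

Import Order.TTheory GRing.Theory Num.Theory.
Import numFieldNormedType.Exports.

Local Open Scope classical_set_scope.
Local Open Scope nat_scope.

(* A coloring of [1, N] is given by c : nat -> 'I_r, of which only the values
   on [1, N] are used. *)
Definition mono_AP (r k N : nat) (c : nat -> 'I_r) : Prop :=
  exists a d : nat, 0 < d /\ exists col : 'I_r,
    forall i, i < k -> 1 <= a + i * d <= N /\ c (a + i * d) = col.

Definition vdW_property (r k N : nat) : Prop :=
  forall c : nat -> 'I_r, mono_AP k N c.

Definition is_vdW (r k N : nat) : Prop :=
  [/\ 0 < N, vdW_property r k N &
      forall M, 0 < M -> vdW_property r k M -> N <= M].

(* W(r, k).  The existence of such an N for positive r and k is van der
   Waerden's theorem; the default value 0 is never a van der Waerden number. *)
Definition vdW (r k : nat) : nat := xget 0 [set N | is_vdW r k N].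

Definition is_base_expansion (r N n : nat) (b : nat -> nat) : Prop :=
  [/\ N = \sum_(i < n.+1) b i * r ^ i,
      1 <= b n <= r - 1 &
      forall i, i < n -> b i <= r - 1].

Definition leading_exponent (r N n : nat) : Prop :=
  exists b : nat -> nat, is_base_expansion r N n b.

Definition admissible (n r k : nat) : Prop :=
  [/\ 1 < r /\ 1 < k,
      maxn r k < vdW r k,
      1 <= n,
      leading_exponent r (vdW r k) n &
      vdW r k < r ^ n.+1 <= r ^ (k ^ 2)].

Definition admissible_set : set (nat * (nat * nat)) :=
  [set t | admissible t.1 t.2.1 t.2.2].

(* Landau filters on triples (n, (r, k)): a big-O along [everywhere_admissible]
   is a bound by one constant on all admissible triples; along
   [large_n_admissible], on those with n beyond some threshold that depends on
   neither r nor k. *)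
Definition everywhere_admissible : set_system (nat * (nat * nat)) :=
  globally admissible_set.

Definition large_n_admissible : set_system (nat * (nat * nat)) :=
  within admissible_set (filter_prod \oo (globally [set: nat * nat])).

#[global] Instance everywhere_admissible_filter : Filter everywhere_admissible.
Proof. exact: globally_filter. Qed.

#[global] Instance large_n_admissible_filter : Filter large_n_admissible.
Proof. exact: within_filter. Qed.

Canonical everywhere_admissible_filter_on :=
  FilterType everywhere_admissible everywhere_admissible_filter.

Canonical large_n_admissible_filter_on :=
  FilterType large_n_admissible large_n_admissible_filter.

(* Main.v *)
Require Import Defs.
From HB Require Import structures.
From mathcomp Require Import all_boot all_order all_algebra.
From mathcomp Require Import all_classical all_reals all_analysis.
From mathcomp Require Import ring.

Import Order.TTheory GRing.Theory Num.Theory.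
Import numFieldNormedType.Exports.

Local Open Scope classical_set_scope.
Local Open Scope ring_scope.

(** Everything rests on the chain [k < W(r,k) < r ^ n.+1]. Taking logarithms of [k < r ^ n.+1] gives
    the lower bound on [n]; taking [n.+1]-th roots gives the first big-O, and dividing
    [W(r,k) < r ^ n.+1] by [r ^ n] gives the second, both with constant 1. The two conditions on [a]
    are the single linear equation [a * ln k = n.+1 * ln r] in disguise, whose unique solution is
    [coef]; its position relative to [n.+1] is that of [ln r / ln k] relative to 1, hence that of
    [r] relative to [k]. *)

Lemma admissible_lt_expn n r k :
  admissible n r k -> [/\ (1 < r)%N, (1 < k)%N & (k < r ^ n.+1)%N].
Proof.
case=> -[r1 k1] rkW _ _ /andP[Wr _]; split=> //.
by rewrite (leq_ltn_trans _ Wr)// (leq_trans (leq_maxr r k))// ltnW.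
Qed.

Lemma ln_natr_gt0 {R : realType} {m : nat} : (1 < m)%N -> 0 < ln (m%:R : R).
Proof. by move=> m1; rewrite ln_gt0// ltr1n. Qed.

Section coefficient.
Variables (R : realType) (n r k : nat).
Hypotheses (r_gt1 : (1 < r)%N) (k_gt1 : (1 < k)%N).

Let coef : R := n.+1%:R * (ln r%:R / ln k%:R).

Let lnr_gt0 : 0 < ln r%:R :> R := ln_natr_gt0 r_gt1.
Let lnk_gt0 : 0 < ln k%:R :> R := ln_natr_gt0 k_gt1.
Let lnr_neq0 : ln r%:R != 0 :> R. Proof. exact: lt0r_neq0. Qed.
Let lnk_neq0 : ln k%:R != 0 :> R. Proof. exact: lt0r_neq0. Qed.
(** The sum [1 + n%:R] is the shape [n.+1%:R] takes in the side conditions left by [field]. *)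
Let n1_neq0 : 1 + n%:R != 0 :> R. Proof. by rewrite nat1r pnatr_eq0. Qed.

Lemma eq_log_coef (x : R) :
  n%:R = x * (ln k%:R / ln r%:R) - 1 <-> x = coef.
Proof.
rewrite /coef; split=> [nx|->].
  have -> : n.+1%:R = x * (ln k%:R / ln r%:R) by rewrite -natr1 nx subrK.
  by field; apply/andP.
apply/eqP; rewrite eq_sym subr_eq natr1; apply/eqP.
by field; apply/andP.
Qed.

(** Logarithms turn the power equation into the linear one; injectivity of [ln] on positive reals
    gives the way back. *)
Lemma eq_powR_coef (x : R) : k%:R = r%:R `^ (n.+1%:R / x) <-> x = coef.
Proof.
have r0 : 0 < r%:R :> R by rewrite ltr0n ltnW.
have k0 : 0 < k%:R :> R by rewrite ltr0n ltnW.
rewrite /coef; split=> [kx|->].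
  (* Since [0^-1 = 0], the value [x = 0] would make the exponent 0 and force [k = 1]. *)
  have [x0|x0] := eqVneq x 0.
    move: kx; rewrite x0 invr0 mulr0 powRr0 => /eqP.
    by rewrite pnatr_eq1 gtn_eqF.
  have -> : ln k%:R = n.+1%:R / x * ln r%:R by rewrite kx ln_powR.
  by field; rewrite x0 lnr_neq0 n1_neq0.
apply: ln_inj; rewrite ?posrE ?powR_gt0// ln_powR.
by field; rewrite lnk_neq0 lnr_neq0 n1_neq0.
Qed.

Lemma coef_lt : (r < k)%N -> coef < n.+1%:R.
Proof.
move=> rk; rewrite /coef gtr_pMr ?ltr0n// ltr_pdivrMr// mul1r.
by rewrite ltr_ln ?posrE ?ltr_nat ?ltr0n// ltnW.
Qed.

Lemma coef_eq : r = k -> coef = n.+1%:R.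
Proof. by move=> rk; rewrite /coef rk divff// mulr1. Qed.

Lemma coef_gt : (k < r)%N -> n.+1%:R < coef.
Proof.
move=> kr; rewrite /coef ltr_pMr ?ltr0n// ltr_pdivlMr// mul1r.
by rewrite ltr_ln ?posrE ?ltr_nat ?ltr0n// ltnW.
Qed.

End coefficient.

Theorem theorem2p3 (R : realType) :
  [/\ forall n r k : nat, admissible n r k ->
        n%:R > ln (k%:R : R) / ln r%:R - 1,
      (fun t : nat * (nat * nat) =>
         t.2.2%:R `^ (t.1.+1%:R^-1) : R^o)
        =O_everywhere_admissible
      (fun t : nat * (nat * nat) => t.2.1%:R : R^o),
      forall n r k : nat, admissible n r k ->
        exists a : R,
          [/\ n%:R = a * (ln k%:R / ln r%:R) - 1,
              forall x : R, n%:R = x * (ln k%:R / ln r%:R) - 1 <->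
                            x = n.+1%:R * (ln r%:R / ln k%:R),
              (r < k)%N -> a < n.+1%:R,
              r = k -> a = n.+1%:R &
              (r > k)%N -> a > n.+1%:R],
      forall n r k : nat, admissible n r k ->
        exists a : R,
          [/\ k%:R = r%:R `^ (n.+1%:R / a),
              forall x : R, k%:R = r%:R `^ (n.+1%:R / x) <->
                            x = n.+1%:R * (ln r%:R / ln k%:R),
              (r < k)%N -> a < n.+1%:R,
              r = k -> a = n.+1%:R &
              (r > k)%N -> a > n.+1%:R] &
      (fun t : nat * (nat * nat) =>
         (vdW t.2.1 t.2.2)%:R / t.2.1%:R ^+ t.1 : R^o)
        =O_large_n_admissible
      (fun t : nat * (nat * nat) => t.2.1%:R : R^o)].
Proof.
split.
- move=> n r k /admissible_lt_expn[r1 k1 kr].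
  (* Clearing the denominator [ln r > 0] leaves [ln k < n.+1 * ln r = ln (r ^ n.+1)]. *)
  rewrite ltrBlDr natr1 ltr_pdivrMr ?ln_natr_gt0// mulr_natl.
  rewrite -lnXn ?ltr0n 1?ltnW// ltr_ln ?posrE ?exprn_gt0 ?ltr0n 1?ltnW//.
  by rewrite -natrX ltr_nat.
- apply/eqO_exP; exists 1 => //.
  move=> [n [r k]] /admissible_lt_expn[/= r1 k1 kr].
  rewrite mul1r ger0_norm ?powR_ge0// ger0_norm ?ler0n//.
  (* With [r] written as an [n.+1]-th root, monotonicity of the root reduces the bound to
     [k <= r ^ n.+1]. *)
  have -> : r%:R = (r%:R ^+ n.+1) `^ n.+1%:R^-1 :> R.
    by rewrite -powR_mulrn ?ler0n// -powRrM divff ?pnatr_eq0// powRr1 ?ler0n.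
  rewrite ge0_ler_powR ?nnegrE ?invr_ge0 ?exprn_ge0 ?ler0n//.
  by rewrite -natrX ler_nat ltnW.
- move=> n r k /admissible_lt_expn[r1 k1 _].
  exists (n.+1%:R * (ln r%:R / ln k%:R)); split.
  + exact/eq_log_coef.
  + exact: eq_log_coef.
  + exact: coef_lt.
  + exact: coef_eq.
  + exact: coef_gt.
- move=> n r k /admissible_lt_expn[r1 k1 _].
  exists (n.+1%:R * (ln r%:R / ln k%:R)); split.
  + exact/eq_powR_coef.
  + exact: eq_powR_coef.
  + exact: coef_lt.
  + exact: coef_eq.
  + exact: coef_gt.
- apply/eqO_exP; exists 1 => //.
  (* The filter lives on admissible triples, so a bound proved on all of them holds along it. *)
  have : large_n_admissible admissible_set by exact: withinT.
  apply: filterS => -[n [r k]] [/= [r1 _] _ _ _ /andP[Wr _]].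
  rewrite mul1r ger0_norm ?divr_ge0 ?exprn_ge0 ?ler0n// ger0_norm ?ler0n//.
  rewrite ler_pdivrMr ?exprn_gt0 ?ltr0n 1?ltnW//.
  by rewrite -exprS -natrX ler_nat ltnW.
Qed.
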